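(* The base polytope $P_{F_7}$ of the Fano matroid $F_7$ admits unimodular flag triangulations.
   Context: The Fano matroid $F_7$ is the rank-$3$ matroid on the ground set $E=\{0,1,\ldots,6\}$ whose bases are all $3$-element subsets of $E$ except the seven triples $012, 034, 056, 135, 146, 236, 245$ (here $ijk$ stands for $\{i,j,k\}$). The base polytope of a matroid $M$ on $E$ with set of bases $\mathcal{B}$ is $P_M=\operatorname{conv}\{\chi_B : B\in\mathcal{B}\}\subseteq\mathbb{R}^E$, where $\chi_B\in\{0,1\}^E$ is the indicator vector of $B$. A triangulation of a finite point configuration $A$ is a set $\Delta$ of simplices with vertices in $A$ that is closed under taking faces, whose union is $\operatorname{conv}(A)$, and such that distinct simplices of $\Delta$ have disjoint relative interiors. A triangulation of $P_M$ is a triangulation of the point configuration $\{\chi_B: B\in\mathcal{B}\}$, which is the vertex set of $P_M$. It is unimodular if every maximal simplex has normalized volume $1$ with respect to the lattice $\operatorname{aff}(P_M)\cap\mathbb{Z}^E$ (equivalently, every lattice point of $\operatorname{aff}(P_M)$ is an integer affine combination of the vertices of the simplex). It is flag if it is the clique complex of its graph ($1$-skeleton), equivalently every minimal non-face has exactly two vertices. *)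

(* Defs.v *)
From mathcomp Require Import all_boot all_order all_algebra.
From mathcomp Require Import finmap.
From mathcomp Require Import boolp classical_sets reals topology normedtype.

Set Implicit Arguments.
Unset Strict Implicit.
Unset Printing Implicit Defensive.

Import Order.TTheory GRing.Theory Num.Theory.
Import numFieldNormedType.Exports.

Local Open Scope ring_scope.

Record matroid (n : nat) := Matroid {
  bases : {set {set 'I_n}};
  bases_neq0 : exists B : {set 'I_n}, B \in bases;
  bases_exchange : forall A B : {set 'I_n}, A \in bases -> B \in bases ->
    forall a : 'I_n, a \in (A :\: B)%SET ->
    exists2 b : 'I_n, b \in (B :\: A)%SET & (b |: (A :\ a))%SET \in bases
}.

Definition fano_triples : seq (seq nat) :=
  [:: [:: 0; 1; 2]; [:: 0; 3; 4]; [:: 0; 5; 6]; [:: 1; 3; 5];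
      [:: 1; 4; 6]; [:: 2; 3; 6]; [:: 2; 4; 5]]%N.

Definition fano_lines : seq {set 'I_7} :=
  [seq [set i : 'I_7 | val i \in t]%SET | t <- fano_triples].

Definition fano_bases : {set {set 'I_7}} :=
  [set B : {set 'I_7} | (#|B| == 3%N) && (B \notin fano_lines)]%SET.

Lemma in_fano_bases (B : {set 'I_7}) :
  (B \in fano_bases) = (#|B| == 3%N) && (B \notin fano_lines).
Proof. exact: finset.in_set. Qed.

Lemma fano_lines_inj (L1 L2 : {set 'I_7}) (x y : 'I_7) :
  L1 \in fano_lines -> L2 \in fano_lines -> x != y ->
  x \in L1 -> y \in L1 -> x \in L2 -> y \in L2 -> L1 = L2.
Proof.
move=> /mapP[s sF ->] /mapP[t tF ->] xy; rewrite !inE => xs ys xt yt.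
suff -> : s = t by [].
have : all (fun s : seq nat => all (fun t : seq nat =>
    all (fun x : nat => all (fun y : nat =>
    (x != y) ==> (x \in s) ==> (y \in s) ==> (x \in t) ==> (y \in t) ==>
    (s == t)) (iota 0 7)) (iota 0 7)) fano_triples) fano_triples.
  by vm_compute.
move=> /allP/(_ _ sF)/allP/(_ _ tF)/allP/(_ (val x)).
rewrite mem_iota ltn_ord => /(_ isT)/allP/(_ (val y)).
rewrite mem_iota ltn_ord => /(_ isT).
by rewrite (inj_eq val_inj) xy xs ys xt yt => /eqP.
Qed.

Lemma fano_bases_neq0 : exists B : {set 'I_7}, B \in fano_bases.
Proof.
pose s := [:: 0; 1; 3]%N.
exists [set i : 'I_7 | val i \in s]%SET.
rewrite in_fano_bases; apply/andP; split.
  rewrite cardsE cardE /enum_mem size_filter -(count_map val (mem s)).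
  by rewrite -enumT val_enum_ord.
apply/negP => /mapP[t tF /setP E].
have : all (fun t : seq nat => ~~ all (fun x : nat => (x \in s) == (x \in t)) (iota 0 7))
  fano_triples by vm_compute.
move=> /allP/(_ _ tF)/negP; apply; apply/allP => x.
rewrite mem_iota => /andP[_ x7].
by have := E (Ordinal x7); rewrite !inE => ->.
Qed.

Lemma fano_bases_exchange (A B : {set 'I_7}) :
  A \in fano_bases -> B \in fano_bases ->
  forall a : 'I_7, a \in (A :\: B)%SET ->
  exists2 b : 'I_7, b \in (B :\: A)%SET & (b |: (A :\ a))%SET \in fano_bases.
Proof.
rewrite !in_fano_bases => /andP[/eqP cA _] /andP[/eqP cB nB] a.
rewrite inE => /andP[aB aA].
have cP : #|(A :\ a)%SET| = 2 by have := cardsD1 a A; rewrite aA cA => -[].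
have /cards2P[x [y [xy EP]]] : #|(A :\ a)%SET| == 2 by rewrite cP.
have cU b : b \in (B :\: A)%SET -> #|(b |: (A :\ a))%SET| = 3.
  by rewrite inE => /andP[bA _]; rewrite cardsU1 !inE (negPf bA) andbF cP.
have [/exists_inP[b bBA bF]|] :=
  boolP [exists b in (B :\: A)%SET, (b |: (A :\ a))%SET \in fano_bases].
  by exists b.
move=> /exists_inPn H.
have L b : b \in (B :\: A)%SET -> (b |: (A :\ a))%SET \in fano_lines.
  by move=> bBA; have := H b bBA; rewrite in_fano_bases (cU b bBA) eqxx negbK.
have [b0 b0P] : exists b0, b0 \in (B :\: A)%SET.
  apply/finset.set0Pn; apply/negP => /eqP/eqP; rewrite finset.setD_eq0 => sBA.
  have /eqP BA : B == A by rewrite eqEcard sBA cA cB.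
  by rewrite BA aA in aB.
exfalso; move: (L b0 b0P) => L0.
have xyU b : x \in (b |: (A :\ a))%SET /\ y \in (b |: (A :\ a))%SET.
  by rewrite EP !inE !eqxx !orbT.
have BL : (B \subset b0 |: (A :\ a))%SET.
  apply/fintype.subsetP => b bB; have [bA|bA] := boolP (b \in A).
    by rewrite !inE bA andbT (_ : b != a) ?orbT //; apply: contraNneq aB => <-.
  have bP : b \in (B :\: A)%SET by rewrite inE bA.
  have [[xb yb] [x0 y0]] := (xyU b, xyU b0).
  rewrite -(fano_lines_inj (L b bP) L0 xy xb yb x0 y0).
  by rewrite !inE eqxx.
have E : B = (b0 |: (A :\ a))%SET by apply/eqP; rewrite eqEcard BL cB cU.
by move/negP: nB; apply; rewrite E.
Qed.

Definition fano : matroid 7 :=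
  Matroid fano_bases_neq0 fano_bases_exchange.

Section Polyhedral.
Variables (R : realType) (n : nat).
Implicit Types (S C L : set 'rV[R]_n) (x : 'rV[R]_n).
Implicit Types (s t A : {fset 'rV[R]_n}) (D : {fset {fset 'rV[R]_n}}).

Local Open Scope classical_set_scope.

Definition aff S : set 'rV[R]_n := [set x |
  exists (s : {fset 'rV[R]_n}) (w : 'rV[R]_n -> R),
    [/\ [set` s] `<=` S, \sum_(v <- s) w v = 1 & x = \sum_(v <- s) w v *: v]].

Definition conv S : set 'rV[R]_n := [set x |
  exists (s : {fset 'rV[R]_n}) (w : 'rV[R]_n -> R),
    [/\ [set` s] `<=` S, forall v, v \in s -> 0 <= w v,
        \sum_(v <- s) w v = 1 & x = \sum_(v <- s) w v *: v]].

Definition relint C : set 'rV[R]_n :=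
  [set x | C x /\ \forall y \near x, aff C y -> C y].

Definition affinely_independent s : Prop :=
  forall w : 'rV[R]_n -> R,
    \sum_(v <- s) w v = 0 -> \sum_(v <- s) w v *: v = 0 ->
    forall v, v \in s -> w v = 0.

(* A simplex is represented by its (affinely independent) set of vertices;
   its faces, the empty one included, are then the subsets of that set. *)
Definition triangulation A D : Prop :=
  [/\ forall s, s \in D -> (s `<=` A)%fset /\ affinely_independent s,
      forall s t, s \in D -> (t `<=` s)%fset -> t \in D,
      [set x | exists2 s, s \in D & conv [set` s] x] = conv [set` A] &
      forall s t, s \in D -> t \in D -> s != t ->
        relint (conv [set` s]) `&` relint (conv [set` t]) = set0].

Definition maximal_simplex D s : Prop :=
  s \in D /\ forall t, t \in D -> (s `<=` t)%fset -> t = s.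

Definition affine_lattice C : set 'rV[R]_n :=
  [set x | aff C x /\ forall i, x 0 i \is a Num.int].

Definition int_aff s : set 'rV[R]_n := [set x |
  exists w : 'rV[R]_n -> int,
    \sum_(v <- s) w v = 1 /\ x = \sum_(v <- s) (w v)%:~R *: v].

(* A maximal simplex has normalized volume 1 with respect to the lattice
   exactly when its vertices generate the lattice affinely over the integers. *)
Definition unimodular C D : Prop :=
  forall s, maximal_simplex D s -> affine_lattice C `<=` int_aff s.

(* For u = v, the condition says that v is a vertex of the complex. *)
Definition clique D s : Prop :=
  forall u v, u \in s -> v \in s -> [fset u; v]%fset \in D.

Definition flag D : Prop := forall s, s \in D <-> clique D s.

End Polyhedral.

Definition chi (R : realType) (n : nat) (B : {set 'I_n}) : 'rV[R]_n :=
  \row_i (i \in B)%:R.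

Definition base_points (R : realType) (n : nat) (M : matroid n) :
    {fset 'rV[R]_n} :=
  [fset chi R B | B in bases M]%fset.

Definition base_polytope (R : realType) (n : nat) (M : matroid n) :
    set 'rV[R]_n :=
  conv [set` base_points R M]%classic.
Arguments base_polytope R [n] M.

(* Main.v *)
(* The triangulation has 232 facets and is invariant under a symmetry of order 7 of
   the Fano plane, so it is given by 34 orbit representatives. It is not a regular
   triangulation, so there is no height function to certify it. Instead, each facet
   comes with its dual basis of functionals, which are integral on the lattice;
   this gives affine independence and unimodularity. Two faces whose relative
   interiors meet coincide because dual functionals of one facet successively separate it
   from the other one down to their common face. The facets cover the polytope: for
   a point z and a generic point y of a facet, take the least m >= 0 such that
   z + m y lies in the cone of some facet; were m positive, the ray would
   leave that facet through the interior of a ridge, which is on the boundary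
   of the polytope or shared with a facet on the other side. *)

Require Import Defs.
From mathcomp Require Import all_boot all_order all_algebra.
From mathcomp Require Import finmap.
From mathcomp Require Import boolp classical_sets reals topology normedtype.
From mathcomp Require Import ring lra.

Set Implicit Arguments.
Unset Strict Implicit.
Unset Printing Implicit Defensive.

Import Order.TTheory GRing.Theory Num.Theory.
Import numFieldNormedType.Exports.

Local Open Scope ring_scope.

(** * Vertices, functionals and facets as integer data *)

(* An automorphism of order 7 of the Fano plane, as a cycle. *)
Definition cyc : seq nat := [:: 1; 3; 2; 5; 6; 4; 0]%N.

Definition base_reps : seq (seq nat) :=
  [:: [:: 0; 1; 2]; [:: 0; 1; 4]; [:: 0; 1; 5]; [:: 0; 2; 4]]%N.

(* Basis number [7 * o + k] is the [k]-th rotation of the [o]-th representative. *)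
Definition base (v : nat) : seq nat :=
  [seq nth 0 cyc ((x + v) %% 7) | x <- nth [::] base_reps (v %/ 7)]%N.

(* The pair [(a, b)] stands for the functional [x |-> a . x + b] on the hyperplane
   where the coordinates sum to 3; [a] is indexed along [cyc]. *)
Definition functional_reps : seq (seq int * int) :=
  [:: ([:: 1; 0; 0; 0; 0; 0; 0], -1);
      ([:: 1; 0; 0; 0; 0; 0; 0], 0);
      ([:: 1; 0; 0; 0; 0; 0; -1], 0);
      ([:: 1; 0; 1; 0; 0; 0; 0], -1);
      ([:: 1; 1; 0; 0; 0; 0; 0], -1);
      ([:: 1; 0; 0; 0; 0; 1; -1], -1);
      ([:: 1; 0; 0; 1; 0; 0; -1], -1);
      ([:: 1; 0; 1; 0; 1; 0; 0], -1);
      ([:: 1; 1; 0; 0; 1; 0; 0], -1);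
      ([:: 1; 1; 0; 1; 0; 0; 0], -2);
      ([:: 1; 0; 1; 0; 0; 1; -1], 0)].

(* Found by computer search: a flag triangulation is determined by choosing one pair
   of bases with each given sum as an edge. *)
Definition facet_reps : seq (seq nat) :=
  [:: [:: 0; 1; 2; 7; 8; 9; 10];
      [:: 0; 1; 2; 7; 8; 9; 15];
      [:: 0; 1; 2; 8; 9; 10; 16];
      [:: 0; 1; 7; 8; 9; 10; 13];
      [:: 0; 1; 7; 8; 10; 13; 14];
      [:: 0; 1; 8; 9; 10; 13; 16];
      [:: 0; 1; 8; 10; 13; 14; 24];
      [:: 0; 1; 8; 10; 13; 16; 24];
      [:: 0; 2; 7; 8; 9; 10; 12];
      [:: 0; 2; 7; 8; 9; 12; 15];
      [:: 0; 2; 7; 8; 10; 12; 18];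
      [:: 0; 2; 7; 8; 12; 15; 18];
      [:: 0; 2; 7; 9; 10; 12; 20];
      [:: 0; 2; 7; 9; 12; 15; 23];
      [:: 0; 2; 7; 9; 12; 20; 23];
      [:: 0; 2; 7; 10; 12; 18; 21];
      [:: 0; 2; 7; 10; 12; 20; 21];
      [:: 0; 2; 7; 12; 15; 18; 23];
      [:: 0; 2; 7; 12; 18; 21; 23];
      [:: 0; 2; 7; 12; 20; 21; 23];
      [:: 0; 2; 8; 9; 10; 12; 16];
      [:: 0; 2; 8; 10; 12; 16; 26];
      [:: 0; 2; 8; 10; 12; 18; 26];
      [:: 0; 2; 9; 10; 12; 16; 20];
      [:: 0; 2; 9; 12; 16; 20; 23];
      [:: 0; 2; 10; 12; 16; 20; 21];
      [:: 0; 2; 10; 12; 16; 21; 26];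
      [:: 0; 2; 10; 12; 18; 21; 26];
      [:: 0; 2; 12; 16; 20; 21; 23];
      [:: 0; 7; 8; 9; 10; 12; 13];
      [:: 0; 7; 9; 10; 12; 13; 20];
      [:: 0; 8; 9; 10; 12; 13; 16];
      [:: 0; 9; 10; 12; 13; 16; 20];
      [:: 7; 8; 9; 10; 11; 12; 13]]%N.

Definition shift (k v : nat) : nat := (v %/ 7 * 7 + (v + k) %% 7)%N.

(** The last representative is invariant under the rotation, so it occurs seven times with its
    vertices permuted: the 238 entries give 232 facets. *)
Definition facets : seq (seq nat) := Eval vm_compute in
  [seq [seq shift k v | v <- s] | s <- facet_reps, k <- iota 0 7].

Definition functionals : seq (seq int * int) := Eval vm_compute in
  [seq ([seq nth 0 f.1 ((index i cyc + k) %% 7) | i <- iota 0 7], f.2)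
     | f <- functional_reps
            ++ [seq ([seq - c | c <- f.1], - f.2) | f <- functional_reps],
       k <- iota 0 7].

Definition value (f : seq int * int) (v : nat) : int :=
  foldr (fun i c => (if i \in base v then nth 0 f.1 i else 0) + c) f.2 (iota 0 7).

Definition row_of (f : seq int * int) : seq int := [seq value f v | v <- iota 0 28].

(* A facet together with the functionals dual to its vertices. *)
Definition cells : seq (seq nat * seq (seq int * int)) := Eval vm_compute in
  let rows := [seq row_of f | f <- functionals] in
  let dual s i := find (fun r => [seq nth 0 r v | v <- s] ==
                     [seq (nat_of_bool (i == k))%:Z | k <- iota 0 7]) rows in
  [seq (s, [seq nth ([::], 0) functionals (dual s i) | i <- iota 0 7]) | s <- facets].

(** Tabulated values at all 28 vertices let the checks below run on plain integers. *)
Definition tables : seq (seq nat * seq (seq int)) := Eval vm_compute in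
  [seq (p.1, [seq row_of f | f <- p.2]) | p <- cells].

(** * Finite checks on the data *)

Lemma facetsE : facets = [seq p.1 | p <- cells].
Proof. by vm_compute. Qed.

Lemma tablesE : tables = [seq (p.1, [seq row_of f | f <- p.2]) | p <- cells].
Proof. by vm_compute. Qed.

Lemma facets_wf : all (fun s => [&& size s == 7%N, uniq s & all (gtn 28) s]) facets.
Proof. by vm_compute. Qed.

Lemma tables_dual : all (fun p =>
  [seq [seq nth 0 r v | v <- p.1] | r <- p.2] ==
  [seq [seq (nat_of_bool (i == k))%:Z | k <- iota 0 7] | i <- iota 0 7]) tables.
Proof. by vm_compute. Qed.

(* A row which is nonnegative on [a] and nonpositive on [b] vanishes on the support
   of every point common to the convex hulls of [a] and [b]. *)
Fixpoint separated_by (rows : seq (seq int)) (a b : seq nat) : bool :=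
  if all (mem b) a then true else
  if rows is r :: rows' then
    if all (fun v => nth 0 r v <= 0) b && all (fun v => 0 <= nth 0 r v) a then
      separated_by rows' [seq v <- a | nth 0 r v == 0] [seq v <- b | nth 0 r v == 0]
    else separated_by rows' a b
  else false.

(* Four passes over the dual basis reach the common face for all pairs of facets. *)
Lemma facets_separated : all (fun p =>
  all (separated_by (flatten (nseq 4 p.2)) p.1) facets) tables.
Proof. by vm_compute. Qed.

(** The functional [c.2] dual to the vertex [c.1] vanishes on the opposite ridge, so its sign tells
    the two sides apart: either the ridge is on the boundary of the polytope, or some facet [t] lies
    across it. *)
Lemma facet_ridges : all (fun p => all (fun c =>
    all (fun v => 0 <= nth 0 c.2 v) (iota 0 28) ||
    let ridge := [seq v <- p.1 | v != c.1] in
    has (fun t => all (fun v => v \in t) ridge &&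
      all (fun v => (v \in ridge) || (nth 0 c.2 v < 0)) t) facets)
  (zip p.1 p.2)) tables.
Proof. by vm_compute. Qed.

Definition adjacency : seq (seq nat) := Eval vm_compute in
  [seq [seq u <- iota 0 28 | has (fun s => (u \in s) && (v \in s)) facets]
     | v <- iota 0 28].

Lemma adjacencyE : adjacency =
  [seq [seq u <- iota 0 28 | has (fun s => (u \in s) && (v \in s)) facets]
     | v <- iota 0 28].
Proof. by vm_compute. Qed.

(** Enumeration of cliques: each vertex of [l] is left out or, if adjacent to all of the current
    clique [c], added to it; [F] keeps the facets containing the clique and must not become empty.
    Conditionals, unlike boolean connectives, keep call-by-value evaluation from exploring sets that
    are not cliques. *)
Fixpoint cliques_covered (l c : seq nat) (F : seq (seq nat)) : bool :=
  if l is v :: l' then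
    if cliques_covered l' c F then
      if all (fun u => u \in nth [::] adjacency v) c then
        cliques_covered l' (v :: c) [seq s <- F | v \in s]
      else true
    else false
  else ~~ nilp F.

Lemma facets_cliques : cliques_covered (iota 0 28) [::] facets.
Proof. by vm_compute. Qed.

(** * Barycentric coordinates in a facet *)

Section Functionals.
Variable R : realType.
Implicit Types (x : 'rV[R]_7) (f : seq int * int) (p : seq nat * seq (seq int * int)).

Definition pt (v : nat) : 'rV[R]_7 := \row_i (val i \in base v)%:R.

(* The linear extension of a functional from the hyperplane where the coordinates
   sum to 3. *)
Definition evalf f x : R :=
  (x *m \col_i ((nth 0 f.1 i)%:~R + f.2%:~R / 3)) 0 0.

Lemma evalf_sum (I : Type) (r : seq I) (P : pred I) f (c : I -> R) (X : I -> 'rV[R]_7) :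
  evalf f (\sum_(i <- r | P i) c i *: X i) = \sum_(i <- r | P i) c i * evalf f (X i).
Proof.
rewrite /evalf mulmx_suml summxE; apply: eq_bigr => i _.
by rewrite -scalemxAl mxE.
Qed.

Lemma evalfD f x y : evalf f (x + y) = evalf f x + evalf f y.
Proof. by rewrite /evalf mulmxDl mxE. Qed.

Lemma evalfZ f c x : evalf f (c *: x) = c * evalf f x.
Proof. by rewrite /evalf -scalemxAl mxE. Qed.

Lemma evalfE f x :
  evalf f x = \sum_(i < 7) (nth 0 f.1 i)%:~R * x 0 i + f.2%:~R / 3 * \sum_(i < 7) x 0 i.
Proof.
rewrite /evalf mxE mulr_sumr -big_split /=; apply: eq_bigr => i _.
by rewrite mxE; ring.
Qed.

Lemma base_wf : all (fun v => count (mem (base v)) (iota 0 7) == 3%N) (iota 0 28).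
Proof. by vm_compute. Qed.

Lemma sum_pt v : (v < 28)%N -> \sum_(i < 7) pt v 0 i = 3.
Proof.
move=> v28; have /allP/(_ v) := base_wf; rewrite mem_iota v28 => /(_ isT)/eqP base3.
under eq_bigr do rewrite mxE.
rewrite -natr_sum -(big_mkord xpredT (fun i => nat_of_bool (i \in base v))).
rewrite -sum1_count big_mkcond in base3.
exact: (congr1 (fun n => n%:R : R) base3).
Qed.

Lemma evalf_pt f v : (v < 28)%N -> evalf f (pt v) = (value f v)%:~R.
Proof.
move=> v28; rewrite evalfE sum_pt //.
rewrite divfK ?pnatr_eq0 //.
have -> : value f v = \sum_(i < 7) (if val i \in base v then nth 0 f.1 i else 0) + f.2.
  rewrite -(big_mkord xpredT (fun i => if i \in base v then nth 0 f.1 i else 0)).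
  by rewrite /value unlock /=; ring.
rewrite rmorphD rmorph_sum; congr (_ + _); apply: eq_bigr => i _.
by rewrite mxE; case: ifP => _; rewrite ?mulr1 ?mulr0.
Qed.

Definition vset (s : seq nat) : {fset 'rV[R]_7} := [fset pt v | v in s]%fset.

Lemma vsetP (s : seq nat) x : reflect (exists2 v, v \in s & x = pt v) (x \in vset s).
Proof.
apply: (iffP (imfsetP _ _ _ _)) => -[v vs ->]; by exists v.
Qed.

Lemma bases_distinct : all (fun u => all (fun v =>
    (u == v) || has (fun i => (i \in base u) != (i \in base v)) (iota 0 7))
  (iota 0 28)) (iota 0 28).
Proof. by vm_compute. Qed.

Lemma pt_inj u v : (u < 28)%N -> (v < 28)%N -> pt u = pt v -> u = v.
Proof.
move=> u28 v28 /rowP E; have /allP/(_ u) := bases_distinct.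
rewrite mem_iota u28 => /(_ isT)/allP/(_ v); rewrite mem_iota v28 => /(_ isT).
case/orP => [/eqP // | /hasP[i]]; rewrite mem_iota => /= i7.
have := E (Ordinal i7); rewrite !mxE /=.
by case: (_ \in _); case: (_ \in _) => // /eqP; rewrite ?oner_eq0 // eq_sym oner_eq0.
Qed.

Lemma facet_wf s : s \in facets -> [/\ size s = 7%N, uniq s & forall v, v \in s -> (v < 28)%N].
Proof.
move=> sF; have /allP/(_ s sF)/and3P[/eqP ? ? /allP lt28] := facets_wf.
by split=> // v /lt28.
Qed.

(** Since [evalf] is linear on the whole space, these are also coordinates for the cone over the
    facet, in which the covering argument takes place. *)
Definition bary p (i : 'I_7) x : R := evalf (nth ([::], 0) p.2 i) x.
Definition vertex p (i : 'I_7) : 'rV[R]_7 := pt (nth 0%N p.1 i).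

Lemma cell_facet p : p \in cells -> p.1 \in facets.
Proof. by move=> pC; rewrite facetsE map_f. Qed.

Lemma facet_cell s : s \in facets -> exists2 p, p \in cells & s = p.1.
Proof. by rewrite facetsE => /mapP. Qed.

Lemma size_cell p : p \in cells -> size p.2 = 7%N.
Proof.
move=> pC; have : all (fun q => size q.2 == 7%N) cells by vm_compute.
by move=> /allP/(_ p pC)/eqP.
Qed.

Lemma cell_table p : p \in cells -> (p.1, [seq row_of f | f <- p.2]) \in tables.
Proof. by move=> pC; rewrite tablesE; apply/mapP; exists p. Qed.

Lemma nth_row_of f v : (v < 28)%N -> nth 0 (row_of f) v = value f v.
Proof. by move=> v28; rewrite (nth_map 0%N) ?size_iota // nth_iota. Qed.

Lemma nth_facet_lt28 s i : s \in facets -> (i < 7)%N -> (nth 0%N s i < 28)%N.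
Proof. by move=> /facet_wf[sz _ h] i7; rewrite h // mem_nth // sz. Qed.

Lemma bary_vertex p i k : p \in cells -> bary p i (vertex p k) = (i == k)%:R.
Proof.
move=> pC; have pF := cell_facet pC; have sz := size_cell pC.
have [sz1 _ _] := facet_wf pF.
have /eqP E := allP tables_dual _ (cell_table pC).
have {E} : nth 0 (nth [::] [seq [seq nth 0 r v | v <- p.1]
    | r <- [seq row_of f | f <- p.2]] i) k = (nat_of_bool (i == k))%:Z.
  rewrite {}E (nth_map 0%N) ?size_iota // nth_iota //.
  by rewrite (nth_map 0%N) ?size_iota // nth_iota.
rewrite -map_comp (nth_map ([::], 0)) ?sz // (nth_map 0%N) ?sz1 // => E.
have k28 := nth_facet_lt28 pF (ltn_ord k).
rewrite /bary /vertex evalf_pt // -nth_row_of // E.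
by case: (i == k).
Qed.

(* A left inverse of a square matrix is a right inverse: the functionals dual
   to the vertices are the coordinates in the basis of these vertices. *)
Lemma bary_sum p x : p \in cells -> x = \sum_(i < 7) bary p i x *: vertex p i.
Proof.
move=> pC.
pose M : 'M[R]_7 := \matrix_(i, j) vertex p i 0 j.
pose C : 'M[R]_7 := \matrix_(j, i)
  ((nth 0 (nth ([::], 0) p.2 i).1 j)%:~R + (nth ([::], 0) p.2 i).2%:~R / 3).
have coordE y i : bary p i y = (y *m C) 0 i.
  by rewrite /bary /evalf !mxE; apply: eq_bigr => j _; rewrite !mxE.
have MC : M *m C = 1%:M.
  apply/matrixP => i k; rewrite [RHS]mxE eq_sym -(bary_vertex k i pC) coordE !mxE.
  by apply: eq_bigr => j _; rewrite !mxE.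
rewrite -[LHS]mulmx1 -(mulmx1C MC) mulmxA; apply/rowP => j.
rewrite mxE summxE; apply: eq_bigr => i _.
by rewrite coordE !mxE.
Qed.

Lemma vertex_inj p : p \in cells -> injective (vertex p).
Proof.
move=> pC i k E; apply/eqP; have := bary_vertex i k pC.
by rewrite -E bary_vertex // eqxx; case: (i == k) => // /eqP; rewrite oner_eq0.
Qed.

Lemma vset_vertexP p x : p \in cells ->
  reflect (exists i, x = vertex p i) (x \in vset p.1).
Proof.
move=> pC; have [sz u _] := facet_wf (cell_facet pC).
apply: (iffP (vsetP _ _)) => [[v /(nthP 0%N)[i]] | [i ->]].
  by rewrite sz => i7 <- ->; exists (Ordinal i7).
by exists (nth 0%N p.1 i) => //; rewrite mem_nth ?sz.
Qed.

Lemma big_vset p (V : nmodType) (F : 'rV[R]_7 -> V) : p \in cells ->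
  \sum_(u <- vset p.1) F u = \sum_(i < 7) F (vertex p i).
Proof.
move=> pC.
have -> : \sum_(i < 7) F (vertex p i) = \sum_(u <- [seq vertex p i | i <- enum 'I_7]) F u.
  by rewrite big_map big_enum.
apply: perm_big; apply: uniq_perm; rewrite ?fset_uniq //.
  by rewrite map_inj_uniq ?enum_uniq //; apply: vertex_inj.
move=> x; apply/(vset_vertexP _ pC)/mapP => [[i ->]|[i _ ->]]; exists i => //.
by rewrite mem_enum.
Qed.

Lemma big_pick (s : {fset 'rV[R]_7}) (w : 'rV[R]_7 -> R) a :
  \sum_(u <- s) w u * (u == a)%:R = if a \in s then w a else 0.
Proof.
case: ifP => as_.
  rewrite (big_fsetD1 a) //= eqxx mulr1 big_seq big1 ?addr0 // => u.
  by rewrite in_fsetD1 => /andP[/negPf-> _]; rewrite mulr0.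
rewrite big_seq big1 // => u us; case: eqP => [ua|]; rewrite ?mulr0 //.
by rewrite -ua us in as_.
Qed.

Lemma bary_comb p i (s : {fset 'rV[R]_7}) (w : 'rV[R]_7 -> R) :
  p \in cells -> (s `<=` vset p.1)%fset ->
  bary p i (\sum_(u <- s) w u *: u) = if vertex p i \in s then w (vertex p i) else 0.
Proof.
move=> pC /fsubsetP sp; rewrite /bary evalf_sum -big_pick.
rewrite big_seq [RHS]big_seq; apply: eq_bigr => u /sp/(vset_vertexP _ pC)[k ->].
rewrite -/(bary p i _) bary_vertex // (inj_eq (vertex_inj pC)) eq_sym //.
Qed.

(** The functional dual to a vertex isolates its coefficient in a vanishing combination. *)
Lemma vset_independent p (s : {fset 'rV[R]_7}) :
  p \in cells -> (s `<=` vset p.1)%fset -> affinely_independent s.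
Proof.
move=> pC sp w _ w0 u us; have /(vset_vertexP _ pC)[i ui] := fsubsetP sp u us.
have := bary_comb i w pC sp; rewrite w0 -ui us => <-.
by rewrite -(scale0r (0 : 'rV[R]_7)) /bary evalfZ mul0r.
Qed.

End Functionals.

(** * Enumeration of the bases of the Fano matroid *)

Lemma card_seq_set (s : seq nat) :
  #|[set i : 'I_7 | val i \in s]%SET| = count (mem s) (iota 0 7).
Proof.
rewrite cardsE cardE /enum_mem size_filter -(count_map val (mem s)).
by rewrite -enumT val_enum_ord.
Qed.

Lemma triples_covered : all (fun i => all (fun j => all (fun k =>
    ~~ uniq [:: i; j; k] || has (fun t => all (mem t) [:: i; j; k])
      (fano_triples ++ [seq base v | v <- iota 0 28]))
  (iota 0 7)) (iota 0 7)) (iota 0 7).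
Proof. by vm_compute. Qed.

Lemma triples_card : all (fun t => count (mem t) (iota 0 7) == 3%N)
  (fano_triples ++ [seq base v | v <- iota 0 28]).
Proof. by vm_compute. Qed.

Lemma bases_not_lines : all (fun v => all (fun t =>
    has (fun i => (i \in base v) != (i \in t)) (iota 0 7)) fano_triples) (iota 0 28).
Proof. by vm_compute. Qed.

(** Any three distinct elements lie in a listed line or basis, and that set has only three elements,
    so it is the given set. *)
Lemma fano_basesP (B : {set 'I_7}) : reflect
  (exists2 v, (v < 28)%N & B = [set i : 'I_7 | val i \in base v]%SET)
  (B \in fano_bases).
Proof.
rewrite in_fano_bases; apply: (iffP andP) => [[/eqP B3 BL]|[v v28 ->]].
  have [x [y [z [xy xz yz EB]]]] : exists x y z : 'I_7,
      [/\ x != y, x != z, y != z & B = [set x; y; z]%SET].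
    have := enum_uniq B; have := mem_enum B; move: B3; rewrite cardE.
    case: (enum B) => [|x [|y [|z []]]] // _ EB; rewrite /= !inE negb_or.
    case/and3P=> /andP[xy xz] yz _; exists x, y, z; split=> //.
    by apply/setP => i; rewrite -EB !inE orbA.
  have ord7 (i : 'I_7) : val i \in iota 0 7 by rewrite mem_iota ltn_ord.
  have u3 : uniq [:: val x; val y; val z].
    by rewrite /= !inE !(inj_eq val_inj) (negPf xy) (negPf xz) (negPf yz).
  have /allP/(_ _ (ord7 x))/allP/(_ _ (ord7 y))/allP/(_ _ (ord7 z)) := triples_covered.
  rewrite u3 => /hasP[t tM /and4P[xt yt zt _]].
  have Et : B = [set i : 'I_7 | val i \in t]%SET.
    apply/eqP; rewrite eqEcard card_seq_set (eqP (allP triples_card _ tM)) B3 leqnn andbT.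
    by rewrite EB; apply/fintype.subsetP => i; rewrite !inE => /orP[/orP[]|] /eqP->.
  move: tM; rewrite mem_cat => /orP[tF|/mapP[v]].
    by case/negP: BL; rewrite Et; apply: map_f.
  by rewrite mem_iota => v28 tE; exists v; rewrite // -tE.
have vI : v \in iota 0 28 by rewrite mem_iota.
split.
  by rewrite card_seq_set; apply: (allP triples_card); rewrite mem_cat map_f ?orbT.
apply/negP => /mapP[t tF /setP E].
have /allP/(_ v vI)/allP/(_ t tF)/hasP[i] := bases_not_lines.
rewrite mem_iota => i7; have := E (Ordinal i7); rewrite !inE /= => ->.
by rewrite eqxx.
Qed.

(** * The complex, and uniqueness of positive combinations *)

Section Triangulation.
Variable R : realType.
Implicit Types (x : 'rV[R]_7) (p : seq nat * seq (seq int * int)).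
Implicit Types s t : {fset 'rV[R]_7}.

Lemma base_points_vset : base_points R fano = vset R (iota 0 28).
Proof.
have chiE v : chi R [set i : 'I_7 | val i \in base v]%SET = pt R v.
  by apply/rowP => i; rewrite !mxE inE.
apply/fsetP => x; apply/imfsetP/vsetP => [[B /fano_basesP[v v28 ->] ->]|[v]].
  exists v; first by rewrite mem_iota.
  exact: chiE.
rewrite mem_iota => v28 ->; exists [set i : 'I_7 | val i \in base v]%SET.
  2: exact/esym/chiE.
by apply/fano_basesP; exists v.
Qed.

Lemma vsetS (a b : seq nat) : {subset a <= b} -> (vset R a `<=` vset R b)%fset.
Proof. by move=> ab; apply/fsubsetP => x /vsetP[v /ab vb ->]; apply/vsetP; exists v. Qed.

Lemma facet_lt28 (a : seq nat) : a \in facets -> {subset a <= iota 0 28}.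
Proof. by move=> /facet_wf[_ _ h] v /h; rewrite mem_iota. Qed.

(** At the common point a separating functional is both nonnegative and nonpositive, hence 0. As all
    weights are positive, it vanishes at every vertex of [s] and [t], so [a] and [b] may be cut down
    to its zero set. *)
Lemma separated_by_sound (rows : seq (seq int)) (a b : seq nat) s t
    (w w' : 'rV[R]_7 -> R) :
  (forall r, r \in rows -> exists f, r = row_of f) ->
  {subset a <= iota 0 28} -> {subset b <= iota 0 28} ->
  (s `<=` vset R a)%fset -> (t `<=` vset R b)%fset ->
  (forall u, u \in s -> 0 < w u) -> (forall u, u \in t -> 0 < w' u) ->
  \sum_(u <- s) w u *: u = \sum_(u <- t) w' u *: u ->
  separated_by rows a b -> (s `<=` vset R b)%fset.
Proof.
move=> rowsP a28 b28 sa tb sw tw swt.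
elim: rows a b rowsP a28 b28 sa tb => [|r rows IH] a b rowsP a28 b28 sa tb /=.
  by case: ifP => // /allP ab _; apply: fsubset_trans sa (vsetS ab).
case: ifP => [/allP ab _|_]; first exact: fsubset_trans sa (vsetS ab).
have rowsP' r' : r' \in rows -> exists f, r' = row_of f.
  by move=> r'r; apply: rowsP; rewrite inE r'r orbT.
case: ifP => [/andP[/allP ble /allP age]|_]; last exact: IH.
have [f rE] := rowsP r (mem_head _ _).
have rv v : v \in iota 0 28 -> (nth 0 r v)%:~R = evalf f (pt R v).
  by rewrite mem_iota => v28; rewrite rE nth_row_of // evalf_pt.
have sge u : u \in s -> 0 <= w u * evalf f u.
  move=> us; have /vsetP[v va uv] := fsubsetP sa u us.
  apply: mulr_ge0; first by rewrite ltW ?sw.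
  by rewrite uv -rv ?a28 // ler0z age.
have tle u : u \in t -> w' u * evalf f u <= 0.
  move=> ut; have /vsetP[v vb uv] := fsubsetP tb u ut.
  apply: mulr_ge0_le0; first by rewrite ltW ?tw.
  by rewrite uv -rv ?b28 // lerz0 ble.
have E : \sum_(u <- s) w u * evalf f u = \sum_(u <- t) w' u * evalf f u.
  by rewrite -!evalf_sum swt.
have s_ge0 : 0 <= \sum_(u <- s) w u * evalf f u by rewrite big_seq sumr_ge0.
have t_le0 : \sum_(u <- t) w' u * evalf f u <= 0 by rewrite big_seq sumr_le0.
have s0 : \sum_(u <- s) w u * evalf f u = 0.
  by apply/eqP; rewrite eq_le s_ge0 E t_le0.
have t0 : \sum_(u <- t) - (w' u * evalf f u) = 0 by rewrite sumrN -E s0 oppr0.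
have szero u : u \in s -> evalf f u = 0.
  move=> us; move/eqP: s0; rewrite big_seq psumr_eq0; last by [].
  by move/allP/(_ u us); rewrite us mulf_eq0 gt_eqF ?sw // => /eqP.
have tzero u : u \in t -> evalf f u = 0.
  move=> ut; move/eqP: t0; rewrite big_seq psumr_eq0; last first.
    by move=> z /tle; rewrite oppr_ge0.
  by move/allP/(_ u ut); rewrite ut oppr_eq0 mulf_eq0 gt_eqF ?tw // => /eqP.
have zsub (c : seq nat) (z : {fset 'rV[R]_7}) : {subset c <= iota 0 28} ->
    (z `<=` vset R c)%fset -> (forall u, u \in z -> evalf f u = 0) ->
    (z `<=` vset R [seq v <- c | nth 0 r v == 0])%fset.
  move=> c28 zc z0; apply/fsubsetP => u uz.
  have /vsetP[v vc uv] := fsubsetP zc u uz; apply/vsetP; exists v => //.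
  by rewrite mem_filter vc andbT -(intr_eq0 R) rv ?c28 // -uv z0.
move=> sep.
have filS (c : seq nat) (P : pred nat) :
    {subset c <= iota 0 28} -> {subset [seq v <- c | P v] <= iota 0 28}.
  by move=> c28 v; rewrite mem_filter => /andP[_ /c28].
have := IH _ _ rowsP' (filS _ _ a28) (filS _ _ b28)
  (zsub _ _ a28 sa szero) (zsub _ _ b28 tb tzero) sep.
move=> /fsubset_trans; apply.
by apply: vsetS => v; rewrite mem_filter => /andP[].
Qed.

Lemma comb_inj p s t (w w' : 'rV[R]_7 -> R) : p \in cells ->
  (s `<=` vset R p.1)%fset -> (t `<=` vset R p.1)%fset ->
  (forall u, u \in s -> 0 < w u) ->
  \sum_(u <- s) w u *: u = \sum_(u <- t) w' u *: u -> (s `<=` t)%fset.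
Proof.
move=> pC sp tp sw E; apply/fsubsetP => u us.
have /(vset_vertexP _ pC)[i ui] := fsubsetP sp u us.
have := bary_comb i w' pC tp; rewrite -E bary_comb // -ui us.
by case: ifP => // _ w0; have := sw u us; rewrite w0 ltxx.
Qed.

Lemma cell_rows p : p \in cells ->
  forall r, r \in flatten (nseq 4 [seq row_of f | f <- p.2]) -> exists f, r = row_of f.
Proof.
move=> pC r /flattenP[l]; rewrite mem_nseq => /andP[_ /eqP->] /mapP[f _ ->].
by exists f.
Qed.

(** Separation puts [s] inside the facet of [q]; there both combinations are expansions in one
    basis, so their supports agree. *)
Lemma positive_comb_inj p q s t (w w' : 'rV[R]_7 -> R) :
  p \in cells -> q \in cells ->
  (s `<=` vset R p.1)%fset -> (t `<=` vset R q.1)%fset ->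
  (forall u, u \in s -> 0 < w u) -> (forall u, u \in t -> 0 < w' u) ->
  \sum_(u <- s) w u *: u = \sum_(u <- t) w' u *: u -> s = t.
Proof.
move=> pC qC sp tq sw tw E; have pF := cell_facet pC; have qF := cell_facet qC.
have /allP/(_ _ qF) := allP facets_separated _ (cell_table pC).
move=> /(separated_by_sound (cell_rows pC) (facet_lt28 pF) (facet_lt28 qF) sp tq sw tw E) sq.
apply/eqP; rewrite eqEfsubset (comb_inj qC sq tq sw E) /=.
exact: comb_inj qC tq sq tw (esym E).
Qed.

Definition fano_complex : {fset {fset 'rV[R]_7}} :=
  [fset s in fpowerset (vset R (iota 0 28)) |
    has (fun a => s `<=` vset R a)%fset facets]%fset.

Lemma fano_complexP s :
  reflect (exists2 p, p \in cells & (s `<=` vset R p.1)%fset) (s \in fano_complex).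
Proof.
rewrite !inE fpowersetE; apply: (iffP andP) => [[_ /hasP[a aF sa]]|[p pC sp]].
  by have [p pC ap] := facet_cell aF; exists p; rewrite -?ap.
have pF := cell_facet pC; split; last by apply/hasP; exists p.1.
exact: fsubset_trans sp (vsetS (facet_lt28 pF)).
Qed.

(** Being listed in the order of [l], the clique [m] selects a branch of the enumeration: its head
    is either the current vertex or comes later. *)
Lemma cliques_covered_sound (l c m : seq nat) (F : seq (seq nat)) :
  cliques_covered l c F -> subseq m l ->
  (forall u v, u \in m ++ c -> v \in m ++ c -> u \in nth [::] adjacency v) ->
  exists2 a, a \in F & {subset m <= a}.
Proof.
elim: l c m F => [|v l IH] c m F /=.
  by case: F => // a F _ /eqP-> _; exists a; rewrite ?mem_head.
case: ifP => // cov1 cov2 ml adj.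
have [ml'|] := boolP (subseq m l); first exact: IH cov1 ml' adj.
case: m ml adj => [|u m] /=; first by rewrite sub0seq.
case: eqP => [-> ml adj _|_ -> _] //.
have uc : all (fun u => u \in nth [::] adjacency v) c.
  by apply/allP => w wc; rewrite adj ?mem_head // inE mem_cat wc !orbT.
rewrite uc in cov2; have [|a] := IH _ _ _ cov2 ml.
  by move=> w w' ww ww'; apply: adj; [move: ww|move: ww'];
    rewrite !(inE, mem_cat) => /or3P[]->; rewrite ?orbT.
rewrite mem_filter => /andP[va aF] ma; exists a => // w.
by rewrite inE => /orP[/eqP->|/ma].
Qed.

End Triangulation.

(** * Convex hulls and relative interiors of simplices *)

Section Convexity.
Variables (R : realType) (n : nat).
Implicit Types (x : 'rV[R]_n) (s t : {fset 'rV[R]_n}).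

Lemma conv_fsetP s x : conv [set` s]%classic x <->
  exists w : 'rV[R]_n -> R,
    [/\ forall u, u \in s -> 0 <= w u, \sum_(u <- s) w u = 1 & x = \sum_(u <- s) w u *: u].
Proof.
split=> [[t [w [ts w0 w1 xE]]]|[w [w0 w1 xE]]]; last by exists s, w; split.
have sub : (t `<=` s)%fset by apply/fsubsetP => u /ts.
exists (fun u => if u \in t then w u else 0); split=> [u us| |].
- by case: ifP => // /w0.
- rewrite -w1 -(big_fset_incl _ sub) => [|u _ /negPf-> //].
  by rewrite big_seq [RHS]big_seq; apply: eq_bigr => u ->.
- rewrite xE -(big_fset_incl _ sub) => [|u _ /negPf->]; last by rewrite scale0r.
  by rewrite big_seq [RHS]big_seq; apply: eq_bigr => u ->.
Qed.

Lemma conv_fsetS s t x : (s `<=` t)%fset ->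
  conv [set` s]%classic x -> conv [set` t]%classic x.
Proof.
move=> /fsubsetP st [r [w [rs w0 w1 xE]]]; exists r, w; split=> // u /rs /=.
exact: st.
Qed.

(** If the weight of [u0] were 0, moving from [x] slightly away from [u0] would stay in the affine
    hull, hence in the simplex; but by independence the new point has weight [- e] at [u0]. *)
Lemma relint_conv s x : affinely_independent s -> relint (conv [set` s]%classic) x ->
  exists w : 'rV[R]_n -> R,
    [/\ forall u, u \in s -> 0 < w u, \sum_(u <- s) w u = 1 & x = \sum_(u <- s) w u *: u].
Proof.
move=> ind [/conv_fsetP[w [w0 w1 xE]] xnear]; exists w; split=> // u0 u0s.
rewrite lt_neqAle w0 // andbT; apply/eqP => wu0.
pose y (e : R) : 'rV[R]_n := x + e *: (x - u0).
have yE e : y e = \sum_(u <- s) ((1 + e) * w u - e * (u == u0)%:R) *: u.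
  under eq_bigr do rewrite scalerBl -!scalerA.
  rewrite sumrB -!scaler_sumr -xE.
  have -> : \sum_(u <- s) (u == u0)%:R *: u = u0.
    rewrite (big_fsetD1 u0) //= eqxx scale1r big_seq big1 ?addr0 // => u.
    by rewrite in_fsetD1 => /andP[/negPf-> _]; rewrite scale0r.
  by rewrite /y scalerBr scalerDl scale1r addrA.
have y1 e : \sum_(u <- s) ((1 + e) * w u - e * (u == u0)%:R) = 1.
  rewrite sumrB -!mulr_sumr w1.
  have -> : \sum_(u <- s) (u == u0)%:R = 1 :> R.
    rewrite (big_fsetD1 u0) //= eqxx big_seq big1 ?addr0 // => u.
    by rewrite in_fsetD1 => /andP[/negPf->].
  by rewrite !mulr1 addrK.
have y_aff e : aff (conv [set` s]%classic) (y e).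
  exists s, (fun u => (1 + e) * w u - e * (u == u0)%:R); split=> // u us.
  apply/conv_fsetP; exists (fun v => (v == u)%:R); split=> [v _| |]; rewrite ?ler0n //.
    rewrite (big_fsetD1 u) //= eqxx big_seq big1 ?addr0 // => v.
    by rewrite in_fsetD1 => /andP[/negPf->].
  rewrite (big_fsetD1 u) //= eqxx scale1r big_seq big1 ?addr0 // => v.
  by rewrite in_fsetD1 => /andP[/negPf-> _]; rewrite scale0r.
have y_cvg : (y e @[e --> (0 : R)] --> x)%classic.
  suff : (y e @[e --> (0 : R)] --> x + 0 *: (x - u0))%classic by rewrite scale0r addr0.
  by apply: cvgD; [exact: cvg_cst | apply: cvgZr_tmp; exact: cvg_id].
have [e e0 /conv_fsetP[w' [w'0 w'1 w'E]]] : exists2 e : R, 0 < e & conv [set` s]%classic (y e).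
  have near_conv : (\forall e \near (0 : R)^'+,
      aff (conv [set` s]) (y e) -> conv [set` s] (y e))%classic.
    exact: (cvg_at_right_filter y_cvg xnear).
  near (0 : R)^'+%classic => e; exists e; first by near: e; exact: nbhs_right_gt.
  by move: (y_aff e); near: e; exact: near_conv.
have := ind (fun u => ((1 + e) * w u - e * (u == u0)%:R) - w' u).
rewrite sumrB y1 w'1 subrr => /(_ erefl).
under eq_bigr do rewrite scalerBl.
rewrite sumrB -yE -w'E subrr => /(_ erefl u0 u0s).
rewrite eqxx -wu0 mulr0 mulr1 sub0r => /eqP.
by rewrite subr_eq0 => /eqP w'u0; have := w'0 u0 u0s; rewrite -w'u0 oppr_ge0 leNgt e0.
Unshelve. all: by end_near. Qed.
End Convexity.

(** * Flagness, disjoint interiors and unimodularity *)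

Section Flag.
Variable R : realType.

Lemma vset28P (x : 'rV[R]_7) :
  reflect (exists2 v, (v < 28)%N & x = pt R v) (x \in vset R (iota 0 28)).
Proof.
by apply: (iffP (vsetP _ _)) => -[v v28 ->]; exists v => //; move: v28; rewrite mem_iota.
Qed.

Lemma fano_complex_faces (s t : {fset 'rV[R]_7}) :
  s \in fano_complex R -> (t `<=` s)%fset -> t \in fano_complex R.
Proof.
move=> /fano_complexP[p pC sp] ts; apply/fano_complexP; exists p => //.
exact: fsubset_trans sp.
Qed.

Lemma fano_complex_flag : flag (fano_complex R).
Proof.
move=> s; split=> [sD u v us vs|cl].
  by apply: fano_complex_faces sD _; apply/fsubsetP => x; rewrite !inE => /orP[]/eqP->.
have s28 u : u \in s -> exists2 v, (v < 28)%N & u = pt R v.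
  move=> us; have /fano_complexP[p pC /fsubsetP/(_ u)] := cl u u us us.
  rewrite !inE eqxx => /(_ isT)/vsetP[v vp uv]; exists v => //.
  by have [_ _ ->] := facet_wf (cell_facet pC).
(* Filtering [iota 0 28] lists the clique as a subsequence, as the enumeration requires. *)
pose m := [seq v <- iota 0 28 | pt R v \in s].
have adj u v : u \in m ++ [::] -> v \in m ++ [::] -> u \in nth [::] adjacency v.
  rewrite cats0 !mem_filter => /andP[us u28] /andP[vs v28].
  rewrite adjacencyE (nth_map 0%N) ?size_iota; last by move: v28; rewrite mem_iota.
  rewrite nth_iota; last by move: v28; rewrite mem_iota.
  rewrite add0n mem_filter u28 andbT; have /fano_complexP[p pC /fsubsetP sp] := cl _ _ us vs.
  have mem_facet w : (w < 28)%N -> pt R w \in vset R p.1 -> w \in p.1.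
    move=> w28 /vsetP[w' w'p /pt_inj -> //].
    by have [_ _ ->] := facet_wf (cell_facet pC).
  rewrite !mem_iota in u28 v28.
  apply/hasP; exists p.1; first exact: cell_facet.
  by rewrite !mem_facet // ?sp // !inE eqxx ?orbT.
have [a aF ma] := cliques_covered_sound facets_cliques (filter_subseq _ _) adj.
have [p pC ap] := facet_cell aF; apply/fano_complexP; exists p => //.
apply/fsubsetP => u us; have [v v28 uv] := s28 u us; apply/vsetP; exists v => //.
by rewrite -ap ma // mem_filter -uv us mem_iota.
Qed.

Lemma fano_complex_disjoint (s t : {fset 'rV[R]_7}) :
  s \in fano_complex R -> t \in fano_complex R -> s != t ->
  (relint (conv [set` s]) `&` relint (conv [set` t]) = set0)%classic.
Proof.
move=> /fano_complexP[p pC sp] /fano_complexP[q qC tq] st; apply/seteqP; split=> // x [].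
move=> /(relint_conv (vset_independent pC sp))[w [w0 _ xw]].
move=> /(relint_conv (vset_independent qC tq))[w' [w'0 _ xw']].
by case/eqP: st; apply: positive_comb_inj pC qC sp tq w0 w'0 _; rewrite -xw.
Qed.

Lemma conv_sum (x : 'rV[R]_7) :
  conv [set` vset R (iota 0 28)]%classic x -> \sum_(i < 7) x 0 i = 3.
Proof.
move=> /conv_fsetP[w [_ w1 ->]].
under eq_bigr do rewrite summxE; rewrite exchange_big /=.
rewrite -[RHS]mul1r -{1}w1 mulr_suml big_seq [RHS]big_seq.
apply: eq_bigr => u /vset28P[v v28 ->].
under eq_bigr do rewrite mxE.
by rewrite -mulr_sumr sum_pt.
Qed.

(** On the hyperplane of coordinate sum 3, the denominator 3 in [evalf] cancels. *)
Lemma bary_int p i (x : 'rV[R]_7) : \sum_(j < 7) x 0 j = 3 ->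
  (forall j, x 0 j \is a Num.int) -> bary p i x \is a Num.int.
Proof.
move=> x3 xint; rewrite /bary evalfE x3 divfK ?pnatr_eq0 //.
by rewrite rpredD ?intr_int // rpred_sum // => j _; rewrite rpredM ?intr_int.
Qed.

(** Compare coordinate sums in the expansion of [x]: [x] and each vertex have sum 3. *)
Lemma sum_bary p (x : 'rV[R]_7) :
  p \in cells -> \sum_(j < 7) x 0 j = 3 -> \sum_(i < 7) bary p i x = 1.
Proof.
move=> pC x3; have nz3 : (3 : R) != 0 by rewrite pnatr_eq0.
apply: (mulIf nz3); rewrite mul1r -[in RHS]x3 [in RHS](bary_sum x pC) mulr_suml.
under [RHS]eq_bigr do rewrite summxE; rewrite [RHS]exchange_big /=; apply: eq_bigr => i _.
under [RHS]eq_bigr do rewrite mxE.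
by rewrite -mulr_sumr sum_pt // nth_facet_lt28 // cell_facet.
Qed.

Lemma fano_complex_unimodular :
  unimodular (conv [set` vset R (iota 0 28)]%classic) (fano_complex R).
Proof.
move=> s [/fano_complexP[p pC sp] smax] x [xaff xint].
have -> : s = vset R p.1.
  by rewrite (smax (vset R p.1)) //; apply/fano_complexP; exists p.
have x3 : \sum_(j < 7) x 0 j = 3.
  have [t [w [tA w1 ->]]] := xaff.
  under eq_bigr do rewrite summxE; rewrite exchange_big /=.
  rewrite -[RHS]mul1r -{1}w1 mulr_suml big_seq [RHS]big_seq; apply: eq_bigr => u /tA uA.
  under eq_bigr do rewrite mxE.
  by rewrite -mulr_sumr conv_sum.
(* The sum picks out the coordinate of the vertex equal to [u]; [Num.floor] turns this integral real
   into an [int]. *)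
pose w (u : 'rV[R]_7) : int := Num.floor (\sum_(i < 7) (vertex R p i == u)%:R * bary p i x).
have wE i : (w (vertex R p i))%:~R = bary p i x.
  rewrite /w (bigD1 i) //= eqxx mul1r big1 ?addr0 => [|k ki].
    by rewrite floorK // bary_int.
  by rewrite (inj_eq (vertex_inj pC)) (negPf ki) mul0r.
exists w; split.
  rewrite big_vset //; apply: (@intr_inj R); rewrite rmorph_sum /=.
  by under eq_bigr do rewrite wE; rewrite sum_bary.
rewrite big_vset //; under eq_bigr do rewrite wE.
exact: bary_sum.
Qed.
End Flag.

(** * Linear inequalities in the parameter of a ray *)

Section Feasibility.
Variable R : realFieldType.
Implicit Types (L : seq (R * R)) (m : R) (c : R * R).

(** A pair [(a, b)] encodes the affine function [a + m * b] of [m]. *)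
Definition feasible L m : Prop := 0 <= m /\ forall c, c \in L -> 0 <= c.1 + m * c.2.

(** The last clause names the obstacle to decreasing [m]: a tight constraint of positive slope. *)
Definition least_feasible L m : Prop :=
  [/\ feasible L m, forall m', feasible L m' -> m <= m' &
      m = 0 \/ exists c, [/\ c \in L, c.1 + m * c.2 = 0 & 0 < c.2]].

(** If a new constraint fails at the old least value [m] but holds at [m0], its slope is positive
    and its root is the new least value. The old constraints hold there, because they hold at both
    [m] and [m0]. *)
Lemma least_feasible_exists L m0 : feasible L m0 -> exists m, least_feasible L m.
Proof.
elim: L => [|[a b] L IH] [m0_ge0 feas0].
  by exists 0; split; [split | move=> m' [] | left].
have [|m [[m_ge0 feas] mle tight]] := IH.
  by split=> // c cL; apply: feas0; rewrite inE cL orbT.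
have sub m' : feasible ((a, b) :: L) m' -> feasible L m'.
  by move=> [m'0 h]; split=> // c cL; apply: h; rewrite inE cL orbT.
have m_le0 : m <= m0 by apply: mle; apply: sub.
have ab0 : 0 <= a + m0 * b by apply: (feas0 (a, b)); rewrite mem_head.
have [abm|abm] := leP 0 (a + m * b).
  exists m; split.
  - by split=> // c; rewrite inE => /predU1P[->|/feas].
  - by move=> m' /sub/mle.
  - case: tight => [|[c [cL ? ?]]]; [by left | right; exists c].
    by split=> //; rewrite inE cL orbT.
have b0 : 0 < b by rewrite ltNge; apply/negP => b0; nra.
have b_neq0 : b != 0 by rewrite gt_eqF.
pose m1 := - a / b.
have m1b : a + m1 * b = 0 by rewrite /m1 divfK // subrr.
have mm1 : m < m1 by rewrite -(ltr_pM2r b0); lra.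
have m1m0 : m1 <= m0 by rewrite -(ler_pM2r b0); lra.
exists m1; split.
- split; first lra; move=> c; rewrite inE => /predU1P[->|cL]; first by rewrite m1b.
  have cm := feas c cL; have cm0 : 0 <= c.1 + m0 * c.2 by apply: feas0; rewrite inE cL orbT.
  have [c0|c0] := leP 0 c.2; first by apply: le_trans cm _; rewrite lerD2l ler_wpM2r // ltW.
  by apply: le_trans cm0 _; rewrite lerD2l ler_wnM2r // ltW.
- move=> m' [_ /(_ (a, b) (mem_head _ _)) /= h]; rewrite -(ler_pM2r b0); lra.
- by right; exists (a, b); rewrite mem_head.
Qed.

Lemma least_feasible_family (T : eqType) (r : seq T) (L : T -> seq (R * R)) p0 m0 :
  p0 \in r -> feasible (L p0) m0 ->
  exists p m, [/\ p \in r, least_feasible (L p) m &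
    forall q m', q \in r -> feasible (L q) m' -> m <= m'].
Proof.
elim: r p0 m0 => // p r IH p0 m0 p0r feas0.
have [[q [m [qr lq qle]]]|none] :=
    pselect (exists q m, [/\ q \in r, least_feasible (L q) m &
      forall q' m', q' \in r -> feasible (L q') m' -> m <= m']).
  have [[mp feasp]|nfp] := pselect (exists m, feasible (L p) m); last first.
    exists q, m; rewrite inE qr orbT; split=> // q' m'.
    rewrite inE => /predU1P[->|q'r] h; last exact: (qle _ _ q'r h).
    by case: nfp; exists m'.
  have [mp' lp] := least_feasible_exists feasp; have [_ ple _] := lp.
  have [mle|mle] := leP m mp'.
    exists q, m; rewrite inE qr orbT; split=> // q' m'.
    rewrite inE => /predU1P[->|q'r] h; last exact: (qle _ _ q'r h).
    exact: le_trans mle (ple _ h).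
  exists p, mp'; rewrite mem_head; split=> // q' m'.
  rewrite inE => /predU1P[->|q'r] h; first exact: ple.
  exact: le_trans (ltW mle) (qle _ _ q'r h).
have nor q m' : q \in r -> ~ feasible (L q) m'.
  by move=> qr h; apply: none; apply: IH qr h.
move: p0r; rewrite inE => /predU1P[p0E|/nor/(_ feas0)//]; subst p0.
have [mp lp] := least_feasible_exists feas0; have [_ ple _] := lp.
exists p, mp; rewrite mem_head; split=> // q' m'.
rewrite inE => /predU1P[->|/nor h /h//]; exact: ple.
Qed.

Lemma feasible_below L m : 0 < m -> (forall c, c \in L -> 0 < c.1 + m * c.2) ->
  exists2 m', m' < m & feasible L m'.
Proof.
(* Feasibility is claimed up to [m], so that [m'] can be raised for each further constraint. *)
move=> m0 pos; suff [m' [m'0 m'm h]] : exists m', [/\ 0 <= m', m' < m &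
    forall k c, m' <= k -> k < m -> c \in L -> 0 <= c.1 + k * c.2].
  by exists m' => //; split=> // c; apply: h.
elim: L pos => [|[a b] L IH] pos; first by exists 0.
have [|m1 [m10 m1m h]] := IH; first by move=> c cL; apply: pos; rewrite inE cL orbT.
have /= ab := pos (a, b) (mem_head _ _).
have [b0|b0] := leP b 0.
  exists m1; split=> // k c mk km; rewrite inE => /predU1P[->|]; last exact: h.
  by apply/ltW/(lt_le_trans ab); rewrite lerD2l ler_wnM2r // ltW.
have b_neq0 : b != 0 by rewrite gt_eqF.
have db : - a / b * b = - a by rewrite divfK.
exists (Num.max m1 (- a / b)); split.
- by rewrite le_max m10.
- by rewrite gt_max m1m -(ltr_pM2r b0) db; lra.
- move=> k c; rewrite ge_max => /andP[mk ak] km.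
  rewrite inE => /predU1P[->|]; last exact: h.
  by move: ak; rewrite -(ler_pM2r b0) db /=; lra.
Qed.

Lemma feasible_above L : (forall c, c \in L -> 0 < c.2) -> exists m, feasible L m.
Proof.
elim: L => [|[a b] L IH] pos; first by exists 0; split.
have [|m [m0 feas]] := IH; first by move=> c cL; apply: pos; rewrite inE cL orbT.
have /= b0 := pos (a, b) (mem_head _ _).
have b_neq0 : b != 0 by rewrite gt_eqF.
have db : - a / b * b = - a by rewrite divfK.
exists (Num.max m (- a / b)); split=> [|c]; first by rewrite le_max m0.
rewrite inE => /predU1P[->|cL] /=.
  have : - a / b <= Num.max m (- a / b) by rewrite le_max lexx orbT.
  by rewrite -(ler_pM2r b0) db; lra.
apply: le_trans (feas c cL) _; rewrite lerD2l ler_wpM2r ?le_max ?lexx //.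
by rewrite ltW // pos // inE cL orbT.
Qed.

Lemma pos_nonroot (P : {poly R}) : P != 0 -> exists2 e, 0 < e & P.[e] != 0.
Proof.
move=> P0; apply: contrapT => none.
(* The [size P] distinct points 1, 2, ... are too many to be all roots. *)
pose r := [seq (k.+1)%:R : R | k <- iota 0 (size P)].
have : (size r < size P)%N.
  apply: max_poly_roots => //.
    apply/allP => _ /mapP[k _ ->]; apply/negPn/negP => nz.
    by apply: none; exists k.+1%:R; rewrite ?ltr0n.
  rewrite map_inj_uniq ?iota_uniq // => i j /eqP.
  by rewrite eqr_nat => /eqP[].
by rewrite size_map size_iota ltnn.
Qed.

End Feasibility.

(** * The facets cover the polytope *)

Section Coverage.
Variable R : realType.
Implicit Types (x y z : 'rV[R]_7) (p q : seq nat * seq (seq int * int)).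

Definition ray z y p : seq (R * R) := [seq (bary p i z, bary p i y) | i <- enum 'I_7].

Lemma baryD p i x y : bary p i (x + y) = bary p i x + bary p i y.
Proof. exact: evalfD. Qed.

Lemma baryZ p i c x : bary p i (c *: x) = c * bary p i x.
Proof. exact: evalfZ. Qed.

Lemma feasible_rayP z y p m : feasible (ray z y p) m <->
  0 <= m /\ forall i, 0 <= bary p i (z + m *: y).
Proof.
split=> -[m0 h]; split=> //.
  move=> i; rewrite baryD baryZ; apply: (h (_, _)).
  by apply: map_f; rewrite mem_enum.
by move=> _ /mapP[i _ ->]; have := h i; rewrite baryD baryZ.
Qed.

(** For [m > 0] the ray avoids the intersection of any two bounding hyperplanes of one cone, so it
    can meet a ridge only in its interior. *)
Definition generic z y : Prop := forall p i j m, p \in cells -> i != j -> 0 < m ->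
  bary p i (z + m *: y) = 0 -> bary p j (z + m *: y) = 0 -> False.

(* The two barycentric coordinates [i] and [j] vanish simultaneously on the ray
   [z + m *: y], [m > 0], only if the functional [a *: bary i + b *: bary j]
   below vanishes at [y]; along the moment curve this is a polynomial condition. *)
Lemma generic_exists z p0 : p0 \in cells ->
  exists2 y, forall i, 0 < bary p0 i y & generic z y.
Proof.
move=> p0C.
(* In general [c] is the determinant of the coordinates [i], [j] of [z] and [x]. If both vanish at
   [z], this is identically 0, and coordinate [i] of [x] is taken instead. *)
pose ab p (i j : 'I_7) : R * R :=
  if (bary p i z == 0) && (bary p j z == 0) then (1, 0) else (bary p j z, - bary p i z).
pose c p i j x := (ab p i j).1 * bary p i x + (ab p i j).2 * bary p j x.
pose y e : 'rV[R]_7 := \sum_(k < 7) e ^+ k *: vertex R p0 k.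
pose Q p i j : {poly R} := \poly_(k < 7) c p i j (vertex R p0 (inord k)).
have QE p i j e : (Q p i j).[e] = c p i j (y e).
  rewrite /Q horner_poly /c /y /bary !evalf_sum !mulr_sumr -big_split /=.
  by apply: eq_bigr => k _; rewrite inord_val; ring.
have Q0 p i j : p \in cells -> i != j -> Q p i j != 0.
  move=> pC ij; apply/eqP => Q0.
  (* A functional vanishing on the basis of vertices of [p0] is 0, which its values at vertices [i]
     and [j] of [p] contradict. *)
  have cv k : c p i j (vertex R p0 k) = 0.
    have := congr1 (fun P : {poly R} => P`_k) Q0.
    by rewrite coef_poly ltn_ord inord_val coef0.
  have c0 x : c p i j x = 0.
    rewrite (bary_sum x p0C) /c /bary !evalf_sum !mulr_sumr -big_split big1 //= => k _.
    transitivity (bary p0 k x * c p i j (vertex R p0 k)); last by rewrite cv mulr0.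
    by rewrite /c /bary; ring.
  have := c0 (vertex R p j); have := c0 (vertex R p i).
  rewrite /c !bary_vertex // !eqxx (negPf ij) [j == i]eq_sym (negPf ij).
  rewrite !mulr1 !mulr0 addr0 add0r.
  rewrite /ab; case: ifP => [_ /eqP|]; first by rewrite oner_eq0.
  by move=> /= nz zj /eqP; rewrite oppr_eq0 => /eqP zi; move: nz; rewrite zi zj eqxx.
pose P : {poly R} := \prod_(p <- cells) \prod_i \prod_(j | i != j) Q p i j.
have P0 : P != 0.
  rewrite prodf_seq_neq0; apply/allP => p pC /=; apply/prodf_neq0 => i _.
  by apply/prodf_neq0 => j ij; apply: Q0.
have [e e0 Pe] := pos_nonroot P0; exists (y e).
  move=> i; rewrite /y /bary evalf_sum (bigD1 i) //= -/(bary _ _ _) bary_vertex // eqxx mulr1.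
  rewrite big1 ?addr0 ?exprn_gt0 // => k ki.
  by rewrite -/(bary _ _ _) bary_vertex // eq_sym (negPf ki) mulr0.
move=> p i j m pC ij m0 zi zj.
have : c p i j (y e) != 0.
  move: Pe; rewrite horner_prod prodf_seq_neq0 => /allP/(_ p pC) /=.
  rewrite horner_prod => /prodf_neq0/(_ i isT).
  by rewrite horner_prod => /prodf_neq0/(_ j ij); rewrite QE.
move: zi zj; rewrite !baryD !baryZ /c /ab => zi zj.
case: ifP => [/andP[/eqP zi0 _]|_] /=.
  move: zi; rewrite zi0 add0r => /eqP; rewrite mulf_eq0 gt_eqF //= => /eqP->.
  by rewrite mulr0 mul0r addr0 eqxx.
suff -> : bary p j z * bary p i (y e) + - bary p i z * bary p j (y e) = 0 by rewrite eqxx.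
have -> : bary p i z = - (m * bary p i (y e)) by lra.
have -> : bary p j z = - (m * bary p j (y e)) by lra.
by ring.
Qed.

(** Geometric form of [facet_ridges]: [q] is the facet across the ridge opposite vertex [i]. *)
Lemma ridge_crossing p i : p \in cells ->
  (forall v, (v < 28)%N -> 0 <= bary p i (pt R v)) \/
  exists q, [/\ q \in cells,
    forall i', i' != i -> exists k, vertex R p i' = vertex R q k &
    forall k, (exists2 i', i' != i & vertex R q k = vertex R p i') \/
      bary p i (vertex R q k) < 0].
Proof.
move=> pC; have [sz up _] := facet_wf (cell_facet pC); have sz2 := size_cell pC.
have rowE v : (v < 28)%N ->
    bary p i (pt R v) = (nth 0 (row_of (nth ([::], 0) p.2 i)) v)%:~R.
  by move=> v28; rewrite /bary evalf_pt // nth_row_of.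
pose cell_i := (nth 0%N p.1 i, row_of (nth ([::], 0) p.2 i)).
have ciz : cell_i \in zip p.1 [seq row_of f | f <- p.2].
  have -> : cell_i = nth (0%N, [::]) (zip p.1 [seq row_of f | f <- p.2]) i.
    by rewrite nth_zip ?size_map ?sz ?sz2 // (nth_map ([::], 0)) ?sz2.
  by rewrite mem_nth // size_zip size_map sz sz2.
have /allP/(_ _ ciz)/orP[/allP ge0|/hasP[t tF /andP[/allP rt /allP tlt]]] :=
    allP facet_ridges _ (cell_table pC).
  by left=> v v28; rewrite rowE // ler0z ge0 // mem_iota.
right; have [q qC tE] := facet_cell tF; exists q.
have qF := cell_facet qC; have [szq _ q28] := facet_wf qF.
split=> // [i' ii'|k].
  have /rt : nth 0%N p.1 i' \in [seq v <- p.1 | v != cell_i.1].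
    by rewrite mem_filter mem_nth ?sz // andbT /= nth_uniq ?sz.
  rewrite tE => /(nthP 0%N)[k]; rewrite szq => k7 E.
  by exists (Ordinal k7); rewrite /vertex E.
have vq : nth 0%N q.1 k \in q.1 by rewrite mem_nth ?szq.
have := tlt (nth 0%N q.1 k); rewrite tE => /(_ vq)/orP[|lt0]; last first.
  by right; rewrite /vertex rowE ?q28 // ltrz0.
rewrite mem_filter => /andP[/= ne /(nthP 0%N)[i']]; rewrite sz => i'7 vE; left.
exists (Ordinal i'7); last by rewrite /vertex vE.
by apply: contra ne => /eqP <-; rewrite vE.
Qed.

Lemma bary_ge0 z p i : conv [set` vset R (iota 0 28)]%classic z ->
  (forall v, (v < 28)%N -> 0 <= bary p i (pt R v)) -> 0 <= bary p i z.
Proof.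
move=> /conv_fsetP[w [w0 _ ->]] pos; rewrite /bary evalf_sum big_seq sumr_ge0 // => u us.
by rewrite mulr_ge0 ?w0 //; have /vset28P[v v28 ->] := us; apply: pos.
Qed.

Lemma cells_cover z : conv [set` vset R (iota 0 28)]%classic z ->
  exists2 p, p \in cells & forall i, 0 <= bary p i z.
Proof.
move=> zP; have [p0 p0C] : exists p0, p0 \in cells.
  by exists (head ([::], [::]) cells); apply: mem_head.
have [y y0 gen] := generic_exists z p0C.
have [m0 feas0] : exists m, feasible (ray z y p0) m.
  by apply: feasible_above => _ /mapP[i _ ->]; apply: y0.
have [p [m [pC [feas mle tight] min]]] := least_feasible_family p0C feas0.
have [m_ge0 pos] := (feasible_rayP z y p m).1 feas.
exists p => // j; have [m_eq0|] := eqVneq m 0.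
  by have := pos j; rewrite m_eq0 scale0r addr0.
case: tight => [->|[_ [/mapP[i _ ->] /= tight yi]]]; first by rewrite eqxx.
move=> m_neq0; have m_gt0 : 0 < m by rewrite lt_neqAle eq_sym m_neq0.
exfalso.
have zi : bary p i (z + m *: y) = 0 by rewrite baryD baryZ.
(* By genericity the point lies in the interior of the ridge. *)
have pos' i' : i' != i -> 0 < bary p i' (z + m *: y).
  move=> ii'; rewrite lt_neqAle pos andbT; apply/eqP => /esym zi'.
  exact: gen pC ii' m_gt0 zi' zi.
have [/(bary_ge0 zP) zi0|[q [qC ridge cross]]] := ridge_crossing i pC.
  by have := mulr_gt0 m_gt0 yi; lra.
(* Change of coordinates from [p] to [q]: a shared vertex contributes only to its own coordinate. *)
have expand k' x : bary q k' x = bary p i x * bary q k' (vertex R p i) +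
    \sum_(i' | i' != i) bary p i' x * (vertex R p i' == vertex R q k')%:R.
  rewrite [in LHS](bary_sum x pC) {1}/bary evalf_sum (bigD1 i) //=; congr (_ + _).
  apply: eq_bigr => i' /ridge[k ->]; rewrite -/(bary _ _ _) bary_vertex //.
  by rewrite (inj_eq (vertex_inj qC)) eq_sym.
(* The constraints of [q] at shared vertices are strict at [m], so they persist slightly below
   [m]. *)
pose L := [seq (bary q k z, bary q k y) |
  k <- enum 'I_7 & [exists i', (i' != i) && (vertex R p i' == vertex R q k)]].
have [|m' m'm [m'0 Lfeas]] := @feasible_below _ L m m_gt0.
  move=> _ /mapP[k' + ->]; rewrite mem_filter => /andP[/existsP[i' /andP[ii' /eqP E]] _] /=.
  rewrite -baryZ -baryD expand zi mul0r add0r (bigD1 i') //= E eqxx mulr1.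
  rewrite big1 ?addr0 ?pos' // => i'' /andP[_ ii''].
  by rewrite -E (inj_eq (vertex_inj pC)) (negPf ii'') mulr0.
suff /(min _ _ qC) : feasible (ray z y q) m' by rewrite leNgt m'm.
apply/feasible_rayP; split=> // k'.
have [k'P|k'N] := boolP [exists i', (i' != i) && (vertex R p i' == vertex R q k')].
  rewrite baryD baryZ; apply: (Lfeas (bary q k' z, bary q k' y)).
  by apply/mapP; exists k' => //; rewrite mem_filter k'P mem_enum.
(* At a vertex of [q] off the ridge, only the term of vertex [i] remains. Its factor is negative
   since the two vertices are on opposite sides. *)
have {}expand x : bary q k' x = bary p i x * bary q k' (vertex R p i).
  rewrite expand big1 ?addr0 // => i' ii'; case: eqP => [E|_]; last by rewrite mulr0.
  by case/existsP: k'N; exists i'; rewrite ii' E eqxx.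
have k'_lt0 : bary p i (vertex R q k') < 0.
  have [[i' ii' E]|//] := cross k'.
  by case/existsP: k'N; exists i'; rewrite ii' E eqxx.
have q_lt0 : bary q k' (vertex R p i) < 0.
  have := expand (vertex R q k'); rewrite bary_vertex // eqxx => E.
  rewrite ltNge; apply/negP => ge0.
  by have := mulr_le0_ge0 (ltW k'_lt0) ge0; rewrite -E ler10.
(* Along the ray [bary p i] increases to 0 at [m], so it is nonpositive at [m'], and the product is
   nonnegative. Thus [q] contradicts the minimality of [m]. *)
rewrite expand mulr_le0 ?(ltW q_lt0) // baryD baryZ.
have : m' * bary p i y <= m * bary p i y by rewrite ler_wpM2r // ltW.
lra.
Qed.

End Coverage.

Theorem proposition5p1 (R : realType) :
  exists D : {fset {fset 'rV[R]_7}},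
    [/\ triangulation (base_points R fano) D,
        unimodular (base_polytope R fano) D
      & flag D].
Proof.
exists (fano_complex R); rewrite /base_polytope base_points_vset.
split; [split|exact: fano_complex_unimodular|exact: fano_complex_flag].
- move=> s /fano_complexP[p pC sp]; split; last exact: vset_independent sp.
  exact: fsubset_trans sp (vsetS R (facet_lt28 (cell_facet pC))).
- exact: fano_complex_faces.
- apply/seteqP; split=> x /=.
    move=> [s /fano_complexP[p pC sp] xs]; apply: (conv_fsetS _ xs).
    exact: fsubset_trans sp (vsetS R (facet_lt28 (cell_facet pC))).
  (* The covering puts [x] in the cone over a facet; its coordinate sum 3 puts it in the facet
     itself. *)
  move=> xP; have [p pC x_ge0] := cells_cover xP.
  exists (vset R p.1); first by apply/fano_complexP; exists p.
  pose w u := \sum_(i < 7) (vertex R p i == u)%:R * bary p i x.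
  have wE i : w (vertex R p i) = bary p i x.
    rewrite /w (bigD1 i) //= eqxx mul1r big1 ?addr0 // => k ki.
    by rewrite (inj_eq (vertex_inj pC)) (negPf ki) mul0r.
  apply/conv_fsetP; exists w; split=> [u _||].
  + by apply: sumr_ge0 => i _; rewrite mulr_ge0 ?ler0n.
  + by rewrite big_vset //; under eq_bigr do rewrite wE; rewrite sum_bary // conv_sum.
  + by rewrite big_vset //; under eq_bigr do rewrite wE; apply: bary_sum.
- exact: fano_complex_disjoint.
Qed.
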